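(* Let $I=\mathbb{R}$ or $I=[a_1,a_2]$ with $-\infty<a_1<a_2<\infty$. Let $v_0,w_0:I\to\mathbb{R}$ be continuous with $v_0(x)\ge w_0(x)$ for all $x\in I$; if $I=[a_1,a_2]$, assume also that $v_0(a_1)=w_0(a_1)$ and $v_0(a_2)=w_0(a_2)$. Then there exist jointly continuous functions $v,w:I\times[0,\infty)\to\mathbb{R}$ with $v(x,0)=v_0(x)$ and $w(x,0)=w_0(x)$ for all $x\in I$, such that: (1) $v(x,t)\ge w(x,t)$ for all $x\in I$, $t\ge 0$; (2) if $I=[a_1,a_2]$ then $v(a_1,t)=w(a_1,t)$ and $v(a_2,t)=w(a_2,t)$ for all $t\ge0$; (3) $(v,w)$ satisfies the thawing condition; (4) for every open set $D\subset I\times(0,\infty)$, if $v>w$ at all points of $D$, or $v=w$ at all points of $D$, then the transport equations with freezing are satisfied by $(v,w)$ in $D$.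
   Context: The system under study is $v_t=-v_x\mathbf 1_{\{v-w>0\}}$, $w_t=w_x\mathbf 1_{\{v-w>0\}}$, interpreted in the following weak sense (no differentiability is required). Transport equations with freezing in an open set $D$. If $v>w$ on $D$, they are satisfied in $D$ if for every $(x,t)\in D$ there is $\varepsilon>0$ such that $v(x+\delta,t+\delta)=v(x,t)$ and $w(x-\delta,t+\delta)=w(x,t)$ for all $\delta\in(-\varepsilon,\varepsilon)$. If $v=w$ on $D$, they are satisfied in $D$ if for every $(x,t)\in D$ there is $\varepsilon>0$ such that $v(x,t+\delta)=v(x,t)$ and $w(x,t+\delta)=w(x,t)$ for all $\delta\in(-\varepsilon,\varepsilon)$. Thawing condition for $(v,w)$. Whenever $s\ge0$ and $x_1<x_2$ (with $(x_1,x_2)\subset I$), and there exist functions $\tilde v,\tilde w$ that are continuous on the triangle $U=\{(x,t): t\ge s,\ x_1+(t-s)<x<x_2-(t-s)\}$, that satisfy $\tilde v>\tilde w$ and the transport equations with freezing in the interior of $U$, and that satisfy $\tilde v(x,s)=v(x,s)$, $\tilde w(x,s)=w(x,s)$ for $x_1<x<x_2$, then $v=\tilde v$ and $w=\tilde w$ in the interior of $U$. *)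

(* Defs.v *)
From HB Require Import structures.
From mathcomp Require Import all_boot all_order all_algebra.
From mathcomp Require Import all_classical all_reals all_analysis.
Set Implicit Arguments.
Unset Strict Implicit.
Unset Printing Implicit Defensive.
Import Order.TTheory GRing.Theory Num.Theory.
Import numFieldNormedType.Exports.
Local Open Scope classical_set_scope.
Local Open Scope ring_scope.

(* Points of space-time are pairs (x, t).  Functions on I, resp. on I x [0, oo[,
   are represented by total functions on R, resp. on R * R, whose values
   outside the domain are irrelevant. *)

Definition line_or_segment (R : realType) (I : set R) : Prop :=
  I = setT \/ exists a1 a2 : R, a1 < a2 /\ I = `[a1, a2]%classic.

(* Void when I is the whole line. *)
Definition agree_at_endpoints (R : realType) (I : set R) (f g : R -> R) : Prop :=
  forall a1 a2 : R, a1 < a2 -> I = `[a1, a2]%classic ->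
    f a1 = g a1 /\ f a2 = g a2.

Definition transport_at (R : realType) (v w : R * R -> R) (x t : R) : Prop :=
  exists2 e : R, 0 < e & forall d : R, - e < d -> d < e ->
    v (x + d, t + d) = v (x, t) /\ w (x - d, t + d) = w (x, t).

Definition frozen_at (R : realType) (v w : R * R -> R) (x t : R) : Prop :=
  exists2 e : R, 0 < e & forall d : R, - e < d -> d < e ->
    v (x, t + d) = v (x, t) /\ w (x, t + d) = w (x, t).

(* Only meaningful, and only used, when v > w on all of D or v = w on all
   of D. *)
Definition transport_with_freezing (R : realType) (v w : R * R -> R)
    (D : set (R * R)) : Prop :=
  ((forall p, D p -> w p < v p) ->
     forall x t, D (x, t) -> transport_at v w x t) /\
  ((forall p, D p -> v p = w p) ->
     forall x t, D (x, t) -> frozen_at v w x t).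

Definition triangle (R : realType) (s x1 x2 : R) : set (R * R) :=
  [set p | [/\ s <= p.2, x1 + (p.2 - s) < p.1 & p.1 < x2 - (p.2 - s)]].

Definition thawing_condition (R : realType) (I : set R) (v w : R * R -> R) :
    Prop :=
  forall s x1 x2 : R, 0 <= s -> x1 < x2 -> `]x1, x2[%classic `<=` I ->
  forall v' w' : R * R -> R,
    {within triangle s x1 x2, continuous v'} ->
    {within triangle s x1 x2, continuous w'} ->
    (forall p, (interior (triangle s x1 x2)) p -> w' p < v' p) ->
    transport_with_freezing v' w' (interior (triangle s x1 x2)) ->
    (forall x, x1 < x -> x < x2 -> v' (x, s) = v (x, s) /\ w' (x, s) = w (x, s)) ->
  forall p, (interior (triangle s x1 x2)) p -> v p = v' p /\ w p = w' p.

(* Main.v *)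
Require Import Defs.
From HB Require Import structures.
From mathcomp Require Import all_boot all_order all_algebra.
From mathcomp Require Import all_classical all_reals all_analysis.
From mathcomp Require Import lra.
Set Implicit Arguments.
Unset Strict Implicit.
Unset Printing Implicit Defensive.
Import Order.TTheory GRing.Theory Num.Theory.
Import numFieldNormedType.Exports.
Local Open Scope classical_set_scope.
Local Open Scope ring_scope.

(** The system is the continuum limit of odd-even transposition sort.  Let v
    carry the labels that travel right and w the labels that travel left.  When
    a label of v meets a label of w at a point, the two are compared: the larger
    one goes on as v, the smaller one as w.  With a time step e this reads

      v'(x) = max (v (x - e)) (w (x + e)),  w'(x) = min (v (x - e)) (w (x + e)).

    If v > w nearby, the comparison changes nothing and the labels pass through
    each other (transport); if v = w increases, every label bounces back
    (freezing).  Because max and min are monotone and 1-Lipschitz, the scheme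
    preserves the modulus of continuity of the initial data in x
    ([evol_modulus]), and its oscillation in time is controlled by the same
    modulus ([evol_time]).  So the schemes of step 1/(i+1) are locally uniformly
    equicontinuous, and a limit along a free ultrafilter on nat defines
    continuous functions v and w; the convergence is locally uniform
    ([limit_uniform]).

    Transport and thawing.  Suppose w(b,s) <= v(a,s) for all a < b of an
    interval.  The scheme at time s satisfies this up to a small error th, and
    the scheme then transports its data up to th throughout the triangle over
    that interval ([evol_transport]); in the limit the transport is exact
    ([limit_transport]).  The thawing condition follows, because a strictly
    ordered solution in the triangle forces that inequality on its base: for
    a < b the characteristics issued from (a,s) and (b,s) meet at an interior
    point, where v' > w'.  Transport on an open set where v > w follows as well,
    by continuity.

    Freezing.  Each comparison preserves v + w, so the mass of v + w over a
    window changes only through its two ends ([evol_flux], [evol_mass]), at a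
    rate governed by v - w.  Where v = w the limiting flux vanishes, so the
    average of v over every small window is constant in time, hence v is
    ([limit_frozen]).

    Endpoints.  On a segment, v and w are unfolded into functions on the whole
    line by reflecting at each multiple of the length and exchanging v with w at
    each reflection.  On the reflected intervals the order is w >= v and the
    comparison is reversed.  The symmetry gives v = w at the endpoints for all
    times, and the scheme needs no boundary rule.  The record [unfolding] states
    what is used of this extension; for I = R there are no mirrors. *)

(** * The sorting scheme *)

Section Compare.
Variable R : realType.

Definition sort2 (b : bool) (p q : R) : R := if b then Num.max p q else Num.min p q.
Arguments sort2 : simpl never.

Lemma sort2_close b (p q p' q' e : R) :
  `|p - p'| <= e -> `|q - q'| <= e -> `|sort2 b p q - sort2 b p' q'| <= e.
Proof.
move=> /ler_normlP[? ?] /ler_normlP[? ?]; apply/ler_normlP; rewrite /sort2.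
by case: b; rewrite ?maxEle ?minEle;
  case: (leP p q) => ?; case: (leP p' q') => ?; split; lra.
Qed.

Lemma sort2_near b (p q a e : R) :
  `|p - a| <= e -> `|q - a| <= e -> `|sort2 b p q - a| <= e.
Proof. by rewrite /sort2; case: b; rewrite ?maxEle ?minEle; case: (leP p q). Qed.

(** Used across a mirror, where one side takes a max and the other a min:
    four cross bounds make the choice irrelevant. *)
Lemma sort2_cross b b' (p q p' q' e : R) :
  `|p - p'| <= e -> `|q - q'| <= e -> `|p - q'| <= e -> `|q - p'| <= e ->
  `|sort2 b p q - sort2 b' p' q'| <= e.
Proof.
by move=> ? ? ? ?; apply: sort2_near; rewrite distrC; apply: sort2_near; rewrite distrC.
Qed.

Lemma sort2C b (p q : R) : sort2 b p q = sort2 b q p.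
Proof. by rewrite /sort2 maxC minC. Qed.

Lemma sort2D (p q : R) : sort2 true p q + sort2 false p q = p + q.
Proof. by rewrite /sort2 maxEle minEle; case: leP => _; rewrite // addrC. Qed.

Lemma dist_chain (a b c d K : R) :
  `|a - c| <= K / 3 -> `|b - c| <= K / 3 -> `|b - d| <= K / 3 -> `|a - d| <= K.
Proof.
by move=> /ler_normlP[? ?] /ler_normlP[? ?] /ler_normlP[? ?]; apply/ler_normlP; split; lra.
Qed.

Lemma sandwich_above (a b c K eta : R) :
  c <= a -> a <= c + K -> `|c - b| <= eta -> `|a - b| <= K + eta.
Proof. by move=> ? ? /ler_normlP[? ?]; apply/ler_normlP; split; lra. Qed.

Lemma sandwich_below (a b c K eta : R) :
  c - K <= a -> a <= c -> `|c - b| <= eta -> `|a - b| <= K + eta.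
Proof. by move=> ? ? /ler_normlP[? ?]; apply/ler_normlP; split; lra. Qed.

End Compare.

Section Sorting.
Variables (R : realType) (up : R -> bool) (wall : set R).

(** The boolean index selects v ([true]) or w ([false]).  On the reflected
    sheets, where [up] fails, v is the smaller function, so that v takes the
    minimum there. *)
Definition sort_step (e : R) (u : bool -> R -> R) : bool -> R -> R :=
  fun b x => sort2 (b == up x) (u true (x - e)) (u false (x + e)).

Definition evol (u0 : bool -> R -> R) (e : R) (k : nat) : bool -> R -> R :=
  iter k (sort_step e) u0.

(** Initial data on the whole line whose symmetry encodes the boundary
    condition v = w on [wall].  A wall point belongs to two sheets, hence the
    exception in [unf_up]. *)
Record unfolding (u0 : bool -> R -> R) : Prop := Unfolding {
  unf_between : forall x y, up x != up y -> x <= y ->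
    exists2 c, wall c & x <= c <= y;
  unf_up : forall c x, wall c -> wall x \/ up (2 * c - x) = ~~ up x;
  unf_reflect : forall c b x, wall c -> u0 b (2 * c - x) = u0 (~~ b) x;
  unf_order : forall x, u0 (~~ up x) x <= u0 (up x) x;
  unf_cont : forall b, continuous (u0 b) }.

Variable u0 : bool -> R -> R.
Hypothesis unf : unfolding u0.
Let wall_between := unf_between unf.
Let up_reflect := unf_up unf.
Let u0_reflect := unf_reflect unf.
Let u0_order := unf_order unf.

Variable e : R.
Hypothesis e0 : 0 <= e.
Notation u := (evol u0 e).

Lemma evolS k b x : u k.+1 b x = sort2 (b == up x) (u k true (x - e)) (u k false (x + e)).
Proof. by []. Qed.

(** The scheme commutes with the reflections.  At a wall the two labels
    that meet are mirror images of each other, hence equal, and it does not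
    matter which of them is taken for v. *)
Lemma evol_reflect k c b x : wall c -> u k b (2 * c - x) = u k (~~ b) x.
Proof.
elim: k c b x => [|k IH] c b x wc; first exact: u0_reflect.
rewrite !evolS.
have -> : 2 * c - x - e = 2 * c - (x + e) by lra.
have -> : 2 * c - x + e = 2 * c - (x - e) by lra.
rewrite !IH //= sort2C; case: (up_reflect x wc) => [wx|->]; last first.
  by case: (b); case: (up x).
(* At a wall x the two arguments are exchanged by the reflection in x. *)
have -> : u k true (x - e) = u k false (x + e).
  by rewrite (_ : x - e = 2 * x - (x + e)) ?IH//; lra.
by rewrite /sort2 maxxx minxx !if_same.
Qed.

Lemma evol_order k x : u k (~~ up x) x <= u k (up x) x.
Proof.
case: k => [|k]; first exact: u0_order.
rewrite !evolS eqxx (_ : (~~ up x == up x) = false); last by case: (up x).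
by rewrite /sort2 ge_min !le_max lexx.
Qed.

Lemma evol_bounded k (M B : R) : 
  (forall b x, `|x| <= M -> `|u0 b x| <= B) ->
  forall b x, `|x| + k%:R * e <= M -> `|u k b x| <= B.
Proof.
move=> hB; elim: k => [|k IH] b x; first by rewrite mul0r addr0; exact: hB.
rewrite -natr1 => h; rewrite evolS -[sort2 _ _ _]subr0.
have [h1 h2] : `|x - e| + k%:R * e <= M /\ `|x + e| + k%:R * e <= M.
  have /= := ler_normB x e; have /= := ler_normD x e; rewrite (ger0_norm e0).
  by split; lra.
by apply: sort2_near; rewrite subr0; apply: IH.
Qed.

(** Two points on sheets of opposite orientation can be brought to the same
    sheet by reflecting one of them in a wall between them.  Reflecting the one
    closer to the wall keeps the new point between x and y, hence inside every
    interval that contains both, and does not increase the distance. *)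
Lemma mirror x y : up x != up y ->
  exists2 z, Num.min x y <= z <= Num.max x y &
    (`|z - y| <= `|x - y| /\ forall k b d, u k b (z - d) = u k (~~ b) (x + d)) \/
    (`|x - z| <= `|x - y| /\ forall k b d, u k b (z - d) = u k (~~ b) (y + d)).
Proof.
move=> xy.
have [c wc hc] : exists2 c, wall c & Num.min x y <= c <= Num.max x y.
  by case: (leP x y) => h; apply: wall_between; rewrite // 1?eq_sym// ltW.
have rfl z k b d : u k b (2 * c - z - d) = u k (~~ b) (z + d).
  by rewrite -(evol_reflect k b _ wc) opprD addrA.
move: hc; case: (leP x y) => h /andP[h1 h2].
- have [hx|hx] := leP (c - x) (y - c).
  + exists (2 * c - x); first by apply/andP; split; lra.
    left; split=> // ; rewrite (ler0_norm (x := x - y)) ?ler_norml; lra.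
  + exists (2 * c - y); first by apply/andP; split; lra.
    right; split=> // ; rewrite (ler0_norm (x := x - y)) ?ler_norml; lra.
- have [hx|hx] := leP (x - c) (c - y).
  + exists (2 * c - x); first by apply/andP; split; lra.
    left; split=> // ; rewrite (ger0_norm (x := x - y)) ?ler_norml; lra.
  + exists (2 * c - y); first by apply/andP; split; lra.
    right; split=> // ; rewrite (ger0_norm (x := x - y)) ?ler_norml; lra.
Qed.

(** A modulus of continuity in x is preserved: max and min are
    1-Lipschitz, and shifts preserve distances.  Points on sheets of opposite
    orientation are compared after a reflection. *)
Lemma evol_modulus (M d eta : R) k :
  (forall b (x y : R), `|x| <= M -> `|y| <= M -> `|x - y| <= d -> `|u0 b x - u0 b y| <= eta) ->
  forall b (x y : R), `|x| + k%:R * e <= M -> `|y| + k%:R * e <= M -> `|x - y| <= d ->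
  `|u k b x - u k b y| <= eta.
Proof.
move=> h0; elim: k => [|k IH] b x y; first by rewrite mul0r !addr0; exact: h0.
rewrite -natr1 => hx hy xy; rewrite !evolS.
have far z : `|z| + (k%:R + 1) * e <= M ->
    `|z - e| + k%:R * e <= M /\ `|z + e| + k%:R * e <= M.
  have /= := ler_normB z e; have /= := ler_normD z e; rewrite (ger0_norm e0).
  by split; lra.
have cm z t : `|z| + (k%:R + 1) * e <= M -> `|t| + (k%:R + 1) * e <= M ->
    `|z - t| <= d -> `|u k true (z - e) - u k true (t - e)| <= eta /\
     `|u k false (z + e) - u k false (t + e)| <= eta.
  move=> /far[? ?] /far[? ?] zt; split; apply: IH => //.
    by rewrite (_ : _ - _ = z - t)//; lra.
  by rewrite (_ : _ - _ = z - t)//; lra.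
have cross z t : `|z| + (k%:R + 1) * e <= M -> `|t| + (k%:R + 1) * e <= M ->
    `|z - t| <= d -> up z != up t ->
    `|u k true (z - e) - u k false (t + e)| <= eta.
  move=> hz ht zt /mirror[s /andP[s1 s2] hs].
  have hs' : `|s| + (k%:R + 1) * e <= M.
    suff : `|s| <= Num.max `|z| `|t| by rewrite le_max => /orP[] ?; lra.
    rewrite ler_norml; apply/andP; split.
      have : - Num.max `|z| `|t| <= Num.min z t.
        rewrite le_min; apply/andP; split; rewrite lerNl le_max.
          by rewrite -normrN ler_norm.
        by rewrite -(normrN t) ler_norm orbT.
      lra.
    have : Num.max z t <= Num.max `|z| `|t|.
      by rewrite ge_max !le_max !ler_norm orbT.
    lra.
  case: hs => -[hd hr].
    have -> : u k true (z - e) = u k false (s + e).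
      by have := hr k false (- e); rewrite opprK => <-.
    exact: (cm _ _ hs' ht (le_trans hd zt)).2.
  rewrite -[u k false _](hr k true).
  exact: (cm _ _ hz hs' (le_trans hd zt)).1.
have [c1 c2] := cm _ _ hx hy xy.
have [<-|ne] := eqVneq (up x) (up y); first exact: sort2_close.
apply: sort2_cross => //; first exact: cross.
by rewrite distrC; apply: cross => //; rewrite 1?distrC// eq_sym.
Qed.

(** By finite propagation speed, only the values at time j within distance d
    of x matter.  They are within eta of the pair at x, which is a fixed
    point of the comparison because it is already ordered. *)
Lemma evol_time j k (x d eta : R) :
  (forall b (y : R), `|y - x| <= d -> `|u j b y - u j b x| <= eta) ->
  forall b (y : R), `|y - x| + k%:R * e <= d -> `|u (j + k)%N b y - u j b x| <= eta.
Proof.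
move=> hd; elim: k => [|k IH] b y.
  by rewrite mul0r addr0 addn0; exact: hd.
rewrite -natr1 addnS => hy; rewrite evolS.
have far z : `|z - x| + (k%:R + 1) * e <= d ->
    `|z - e - x| + k%:R * e <= d /\ `|z + e - x| + k%:R * e <= d.
  have /= := ler_normB (z - x) e; have /= := ler_normD (z - x) e.
  rewrite (ger0_norm e0) (addrAC z (-x)) (addrAC z (-x)).
  by split; lra.
have [f1 f2] := far _ hy.
have c1 := IH true _ f1; have c2 := IH false _ f2.
have [yx|ne] := eqVneq (up y) (up x).
  (* The ordered pair at x is a fixed point of the comparison. *)
  have -> : u j b x = sort2 (b == up y) (u j true x) (u j false x).
    have := evol_order j x; rewrite yx /sort2.
    by case: b; case: (up x) => /= h; case: ltgtP h.
  exact: sort2_close.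
have [c wc hc] : exists2 c, wall c & Num.min x y <= c <= Num.max x y.
  by case: (leP x y) => h; apply: wall_between; rewrite // 1?eq_sym// ltW.
have hy' : `|2 * c - y - x| <= `|y - x|.
  rewrite ler_norml; move: hc; case: (leP x y) => h /andP[? ?].
    by rewrite ger0_norm ?subr_ge0//; apply/andP; split; lra.
  by rewrite ltr0_norm ?subr_lt0//; apply/andP; split; lra.
have /far[f3 f4] : `|2 * c - y - x| + (k%:R + 1) * e <= d by lra.
have rfl z b' : u (j + k) b' (2 * c - y + z) = u (j + k) (~~ b') (y - z).
  by rewrite -(evol_reflect _ b' _ wc); congr u; lra.
have := IH false _ f4; have := IH true _ f3.
rewrite !rfl opprK /= => c3 c4.
by apply: sort2_near; case: (b).
Qed.

(** With A and B the transported values of v and w, the bounds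
    A <= v <= A + th and B - th <= w <= B are invariant under a comparison as
    soon as B <= A + th.  One-sided bounds keep the error from accumulating. *)
Lemma evol_transport j (r x th : R) : 0 <= th ->
  (forall y : R, `|y - x| <= r -> up y) ->
  (forall a b : R, a <= b -> `|a - x| <= r -> `|b - x| <= r ->
    u j false b <= u j true a + th) ->
  forall i (y : R), `|y - x| + i%:R * e <= r ->
  [/\ u j true (y - i%:R * e) <= u (j + i)%N true y,
      u (j + i)%N true y <= u j true (y - i%:R * e) + th,
      u j false (y + i%:R * e) - th <= u (j + i)%N false y &
      u (j + i)%N false y <= u j false (y + i%:R * e)].
Proof.
move: (e0) => e_ge0 th0 hup hth; elim=> [|i IH] y.
  by rewrite mul0r subr0 !addr0 addn0 => hy; split; lra.
rewrite -natr1 addnS => hy; rewrite !evolS.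
have ie0 : 0 <= i%:R * e by rewrite mulr_ge0.
have ie1 : 0 <= (i%:R + 1) * e by lra.
rewrite hup /sort2 /=; last by lra.
have := ler_normB (y - x) e; have := ler_normD (y - x) e.
rewrite (ger0_norm e0) (addrAC y (-x)) (addrAC y (-x)) => n1 n2.
have [|a1 a2 _ _] := IH (y - e); first by lra.
have [|_ _ b1 b2] := IH (y + e); first by lra.
have := hth (y - (i%:R + 1) * e) (y + (i%:R + 1) * e).
have eA : y - e - i%:R * e = y - (i%:R + 1) * e by lra.
have eB : y + e + i%:R * e = y + (i%:R + 1) * e by lra.
rewrite eA eB in a1 a2 b1 b2.
have d1 : `|y - (i%:R + 1) * e - x| <= r.
  by apply: le_trans hy; rewrite (addrAC y) (le_trans (ler_normB _ _))// (ger0_norm ie1).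
have d2 : `|y + (i%:R + 1) * e - x| <= r.
  by apply: le_trans hy; rewrite (addrAC y) (le_trans (ler_normD _ _))// (ger0_norm ie1).
move=> h; have {h} := h _ d1 d2; move/(_ ltac:(lra)) => h.
split; rewrite ?le_max ?ge_max ?le_min ?ge_min ?a1 ?a2 ?b1 ?b2 ?orbT ?andbT//=.
  exact: le_trans b2 h.
by apply: le_trans a1; rewrite lerBlDr.
Qed.

Lemma evol_sum k x : u k.+1 true x + u k.+1 false x = u k true (x - e) + u k false (x + e).
Proof. by rewrite !evolS; case: (up x) => /=; [|rewrite addrC]; exact: sort2D. Qed.

Definition flux k x := u k.+1 true (x - e) - u k false x.

(** A conservation law over two time steps, which return to the same
    lattice points. *)
Lemma evol_flux k x :
  (u k.+2 true x + u k.+2 false x) - (u k true x + u k false x)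
  = flux k x - flux k (x + 2 * e).
Proof.
have h1 := evol_sum k.+1 x; have h2 := evol_sum k (x + e).
rewrite addrK in h2.
have E1 : x + e + e = x + 2 * e by lra.
have E2 : x + 2 * e - e = x + e by lra.
by rewrite /flux E2; rewrite E1 in h2; lra.
Qed.

(** Summing the conservation law over a window of m cells and over N double
    steps: the fluxes telescope and leave only the two ends of the window. *)
Lemma evol_mass k (x : R) m N (K : R) :
  (forall i, (i < N)%N -> `|flux (k + 2 * i) x| <= K /\
     `|flux (k + 2 * i) (x + m%:R * (2 * e))| <= K) ->
  `|\sum_(j < m) ((u (k + 2 * N)%N true (x + j%:R * (2 * e))
                  + u (k + 2 * N)%N false (x + j%:R * (2 * e))) -
                 (u k true (x + j%:R * (2 * e))
                  + u k false (x + j%:R * (2 * e))))| <= N%:R * (2 * K).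
Proof.
elim: N => [|N IH] hK.
  by rewrite muln0 addn0 mul0r big1 ?normr0// => j _; rewrite subrr.
rewrite -(natr1 N) (mulrDl N%:R) mul1r.
have -> : (k + 2 * N.+1 = (k + 2 * N).+2)%N by rewrite mulnS addnCA.
set k' := (k + 2 * N)%N.
rewrite (eq_bigr (fun j : 'I_m =>
  ((u k' true (x + j%:R * (2 * e)) + u k' false (x + j%:R * (2 * e))) -
   (u k true (x + j%:R * (2 * e)) + u k false (x + j%:R * (2 * e)))) +
  (flux k' (x + j%:R * (2 * e)) - flux k' (x + j%:R * (2 * e) + 2 * e))));
  last by move=> j _; rewrite -evol_flux [RHS]addrC subrKA.
rewrite big_split /= (le_trans (ler_normD _ _))// lerD//.
  by apply: IH => i iN; apply: hK; rewrite ltnS ltnW.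
have -> : \sum_(j < m) (flux k' (x + j%:R * (2 * e)) -
      flux k' (x + j%:R * (2 * e) + 2 * e)) = flux k' x - flux k' (x + m%:R * (2 * e)).
  elim: m {IH hK} => [|m IHm]; first by rewrite big_ord0 mul0r addr0 subrr.
  rewrite big_ord_recr /= IHm subrKA; congr (_ - flux _ _).
  by rewrite -(natr1 m); lra.
have [h1 h2] := hK N (ltnSn _).
have -> : 2 * K = K + K by lra.
by rewrite (le_trans (ler_normB _ _))// lerD.
Qed.

End Sorting.

(** * Limits along an ultrafilter *)

Section UltraLimit.
Variables (R : realType) (U : set_system nat).
Hypothesis UU : UltraFilter U.
Hypothesis U_oo : \oo `<=` U.

Definition ulim (a : nat -> R) (l : R) : Prop :=
  forall eta, 0 < eta -> U [set i | `|a i - l| <= eta].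

(** The limit is the supremum of the levels that the sequence exceeds along
    the ultrafilter. *)
Lemma ulim_exists (a : nat -> R) B : (forall i, `|a i| <= B) -> exists l, ulim a l.
Proof.
move=> hB; pose S := [set c | U [set i | c <= a i]].
have S0 : S (- B).
  apply: filterS (filterT : U setT) => i _ /=.
  by have := hB i; rewrite ler_norml => /andP[].
have Sub c : S c -> c <= B.
  move=> /filter_ex[i /= h]; apply: (le_trans h).
  by have := hB i; rewrite ler_norml => /andP[].
have supS : has_sup S by split; [exists (- B) | exists B].
exists (sup S) => eta n0.
have [c Sc hc] : exists2 c, S c & sup S - eta < c by apply: sup_adherent.
(* The ultrafilter decides the level sup S + eta; the definition of sup S excludes it. *)
have [h|h] := in_ultra_setVsetC [set i | sup S + eta <= a i] UU.
  have : S (sup S + eta) by [].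
  by move=> /(ub_le_sup supS.2); rewrite gerDl leNgt n0.
move: Sc; rewrite /S /= => Sc.
apply: filterS (filterI Sc h) => i [/= h1 /negP h2].
by rewrite ler_norml; move: h2; rewrite -ltNge; lra.
Qed.

Lemma ulim_le (a b : nat -> R) la lb K :
  ulim a la -> ulim b lb -> U [set i | a i <= b i + K] -> la <= lb + K.
Proof.
move=> ha hb hab; apply/ler_addgt0Pr => eta n0.
have n2 : 0 < eta / 2 by lra.
have [i /= [[]]] := filter_ex (filterI (filterI (ha _ n2) (hb _ n2)) hab).
by rewrite /= !ler_norml; lra.
Qed.

Lemma ulim_dist (a b : nat -> R) la lb K :
  ulim a la -> ulim b lb -> U [set i | `|a i - b i| <= K] -> `|la - lb| <= K.
Proof.
move=> ha hb hab.
have h1 : la <= lb + K.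
  apply: (ulim_le ha hb); apply: filterS hab => i /=; rewrite ler_norml; lra.
have h2 : lb <= la + K.
  apply: (ulim_le hb ha); apply: filterS hab => i /=; rewrite ler_norml; lra.
by rewrite ler_norml; lra.
Qed.

Lemma ulim_cst (c : R) : ulim (fun=> c) c.
Proof.
move=> eta n0; apply: filterS (filterT : U setT) => i _ /=.
by rewrite subrr normr0 ltW.
Qed.

Lemma ulim_mesh eta : 0 < eta -> U [set i | (i.+1%:R^-1 : R) <= eta].
Proof.
move=> n0; apply: U_oo.
near=> i; rewrite /= ltW//.
by near: i; exact: (near_infty_natSinv_lt (PosNum n0)).
Unshelve. all: by end_near. Qed.

Lemma ulim_continuous (f : R -> R) (a : nat -> R) l : {for l, continuous f} ->
  ulim a l -> ulim (f \o a) (f l).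
Proof.
move=> /cvgrPdist_le cf ha eta n0.
have /nbhs_ballP[d /= d0 hd] := cf _ n0.
have d2 : 0 < d / 2 by lra.
apply: filterS (ha _ d2) => i /= h; rewrite distrC; apply: hd.
by rewrite /ball /= distrC; lra.
Qed.

Lemma local_bound (f : R -> R) M : continuous f ->
  exists B, forall x, `|x| <= M -> `|f x| <= B.
Proof.
move=> cf; apply/not_existsP => h.
have {}h (i : nat) : exists x, `|x| <= M /\ i%:R < `|f x|.
  have /existsNP[x /not_implyP[? /negP]] := h i%:R.
  by rewrite -ltNge; exists x.
have [x hx] := choice h.
have [l hl] := ulim_exists (fun i => (hx i).1).
have h1 := ulim_continuous (@cf l) hl ltr01.
have h2 : U [set i | `|f l| + 1 <= i%:R].
  apply: U_oo; exists (Num.truncn (`|f l| + 1)).+1 => // i /= hi.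
  by rewrite (le_trans (ltW (truncnS_gt _)))// ler_nat.
have [i /= [h3 h4]] := filter_ex (filterI h1 h2).
have [_] := hx i.
have /= := ler_distD 0 (f (x i)) (f l).
have := lerB_dist (f (x i)) (f l); rewrite /comp/= in h3.
by lra.
Qed.

Lemma uniform_modulus (f : R -> R) (M eta : R) : continuous f -> 0 < eta ->
  exists2 d, 0 < d & forall x y, `|x| <= M -> `|y| <= M -> `|x - y| <= d ->
    `|f x - f y| <= eta.
Proof.
move=> cf n0; apply: contrapT => h.
have {}h (i : nat) : exists p : R * R,
  [/\ `|p.1| <= M, `|p.2| <= M, `|p.1 - p.2| <= i.+1%:R^-1 & eta < `|f p.1 - f p.2|].
  apply: contrapT => h'; apply: h; exists (i.+1%:R^-1); first by rewrite invr_gt0.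
  move=> x y hx hy hxy; rewrite leNgt; apply/negP => hn.
  by apply: h'; exists (x, y).
have [p hp] := choice h.
have [l hl] : exists l, ulim (fun i => (p i).1) l.
  by apply: (@ulim_exists _ M) => i; case: (hp i).
have hl' : ulim (fun i => (p i).2) l.
  move=> k k0; have k2 : 0 < k / 2 by lra.
  apply: filterS (filterI (hl _ k2) (ulim_mesh k2)) => i [/= h1 h2].
  have [_ _ h3 _] := hp i; move: h1 h2 h3; set z := i.+1%:R^-1.
  by rewrite !ler_norml => /andP[? ?] ? /andP[? ?]; apply/andP; split; lra.
have n2 : 0 < eta / 3 by lra.
have h1 := ulim_continuous (@cf l) hl n2.
have h2 := ulim_continuous (@cf l) hl' n2.
have [i /= []] := filter_ex (filterI h1 h2).
have [_ _ _] := hp i; rewrite /comp /= !ler_norml lter_normr.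
by case/orP; lra.
Qed.

End UltraLimit.

(** * Neighbourhoods and characteristics in space-time *)

Section SpaceTime.
Variable R : realType.

Lemma nbhs_box (p : R * R) (A : set (R * R)) :
  nbhs p A <-> exists2 r : R, 0 < r &
    forall y t, `|y - p.1| < r -> `|t - p.2| < r -> A (y, t).
Proof.
split.
  move=> [[B C] /= [/nbhs_ballP[r /= r0 hr] /nbhs_ballP[r' /= r'0 hr']] hBC].
  exists (Num.min r r'); first by rewrite lt_min r0 r'0.
  move=> y t; rewrite !lt_min => /andP[y1 _] /andP[_ t1]; apply: hBC; split => /=.
    by apply: hr; rewrite /ball /= distrC.
  by apply: hr'; rewrite /ball /= distrC.
move=> [r r0 h]; exists (ball p.1 r, ball p.2 r) => /=.
  by split; exact: nbhsx_ballx.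
by move=> [y t] [] /=; rewrite /ball /= distrC => ? ; rewrite distrC => ?; exact: h.
Qed.

(** The base is the only part of its boundary that the triangle
    contains. *)
Lemma interior_triangle (s x1 x2 x t : R) :
  interior (triangle s x1 x2) (x, t) <->
  [/\ s < t, x1 + (t - s) < x & x < x2 - (t - s)].
Proof.
rewrite /interior; split.
  move=> /nbhs_box[r r0 h].
  have xx : `|x - (x, t).1| < r by rewrite subrr normr0.
  have tt : `|t - r / 2 - (x, t).2| < r.
    by rewrite /= addrAC subrr add0r normrN gtr0_norm; lra.
  have [/= h1 _ _] := h _ _ xx tt.
  have [/= _ h2 h3] : triangle s x1 x2 (x, t) by apply: h => //=; rewrite subrr normr0.
  by split => //; lra.
move=> [h1 h2 h3]; apply/nbhs_box.
pose r := Num.min (t - s) (Num.min (x - (x1 + (t - s))) (x2 - (t - s) - x)) / 2.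
have [r0 r1 [r2 r3]] : [/\ 0 < r, 2 * r <= t - s &
    2 * r <= x - (x1 + (t - s)) /\ 2 * r <= x2 - (t - s) - x].
  rewrite /r mulrCA divff// mulr1 !ge_min !lexx !orbT; split=> //.
  by rewrite divr_gt0// !lt_min; apply/andP; split; [|apply/andP; split]; lra.
exists r => // y t' /=; rewrite !ltr_norml => /andP[? ?] /andP[? ?].
by split => /=; lra.
Qed.

Lemma locally_constant (f : R -> R) (a b : R) : a <= b ->
  (forall z, a <= z -> z <= b ->
     exists2 e, 0 < e & forall d, - e < d -> d < e -> f (z + d) = f z) ->
  f a = f b.
Proof.
move=> ab h.
have nr z : a <= z -> z <= b -> \forall y \near z, f z = f y.
  move=> az zb; have [e e0 he] := h z az zb.
  apply/nbhs_ballP; exists e => //= y; rewrite /ball /= ltr_norml => /andP[y1 y2].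
  by rewrite -(he (y - z)) ?[z + _]addrC ?subrK//; lra.
have [c _] : exists2 c, c \in `[a, b] & f b - f a = 0 * (b - a).
  apply: (@MVT_segment _ f (fun=> 0)) => //.
    move=> x; rewrite in_itv /= => /andP[/ltW x1 /ltW x2].
    exact: near_eq_is_derive (nr _ x1 x2) (is_derive_cst _ _ _).
  apply: continuous_in_subspaceT => x; rewrite inE /= in_itv /= => /andP[x1 x2].
  apply/cvgrPdist_le => eta n0; apply: filterS (nr x x1 x2) => y <-.
  by rewrite subrr normr0 ltW.
by rewrite mul0r => /subr0_eq.
Qed.

(** Constancy along the line of speed c up to the base of the triangle: an
    interior point is reached by local constancy, the base by continuity. *)
Lemma characteristic (A : set (R * R)) (g : R * R -> R) (a s c r : R) :
  {within A, continuous g} -> A (a, s) -> 0 < r ->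
  (forall z, 0 < z -> z <= r -> A (a + c * z, s + z) /\
     exists2 e, 0 < e & forall d, - e < d -> d < e ->
       g (a + c * (z + d), s + (z + d)) = g (a + c * z, s + z)) ->
  g (a + c * r, s + r) = g (a, s).
Proof.
move=> /subspace_continuousP cg Aas r0 h.
apply/eqP; rewrite -subr_eq0 -normr_le0; apply/ler_addgt0Pr => eta n0; rewrite add0r.
have /cvgrPdist_le/(_ eta n0) := cg _ Aas.
rewrite /prop_near1 /within /= => /nbhs_box[d /= d0 hd].
(* The point of parameter z lies both on the characteristic and in the square of continuity of half-width d. *)
pose z := Num.min r (d / (`|c| + 1) / 2).
have c0 : 0 < `|c| + 1 by have := normr_ge0 c; lra.
have q0 : 0 < d / (`|c| + 1) by rewrite divr_gt0.
have [z0 z1 z2] : [/\ 0 < z, z <= r & z <= d / (`|c| + 1) / 2].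
  by rewrite /z !ge_min !lexx orbT lt_min r0; split => //=; lra.
have zd : (`|c| + 1) * z < d.
  by rewrite mulrC -ltr_pdivlMr//; lra.
have -> : g (a + c * r, s + r) = g (a + c * z, s + z).
  apply/esym/(@locally_constant (fun z => g (a + c * z, s + z))) => // y zy yr.
  by apply: (h y _ yr).2; lra.
rewrite distrC; apply: hd; last by case: (h z z0 z1).
  rewrite (addrC a) addrK normrM (gtr0_norm z0); have := normr_ge0 c; lra.
by rewrite (addrC s) addrK (gtr0_norm z0); have := mulr_ge0 (normr_ge0 c) (ltW z0); lra.
Qed.
End SpaceTime.

Section Average.
Variable R : realType.

(** If all terms are close to c, a bound on their sum bounds c; this
    passes from the average over a window to a value at a point. *)
Lemma sum_close (f : nat -> R) (m : nat) (c eta K : R) :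
  (forall j, (j < m)%N -> `|f j - c| <= eta) -> `|\sum_(j < m) f j| <= K ->
  m%:R * `|c| <= K + m%:R * eta.
Proof.
move=> hf hK.
have h : `|\sum_(j < m) f j - m%:R * c| <= m%:R * eta.
  have -> : \sum_(j < m) f j - m%:R * c = \sum_(j < m) (f j - c).
    by rewrite sumrB sumr_const card_ord mulr_natl.
  apply: le_trans (ler_norm_sum _ _ _) _.
  rewrite mulr_natl -[leRHS](_ : \sum_(j < m) eta = _); last first.
    by rewrite sumr_const card_ord.
  by apply: ler_sum => j _; apply: hf.
have <- : `|m%:R * c| = m%:R * `|c| by rewrite normrM (ger0_norm (ler0n _ m)).
have := ler_normB (\sum_(j < m) f j) (\sum_(j < m) f j - m%:R * c).
by rewrite subKr; lra.
Qed.

End Average.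

(** * The continuum limit *)

Section Limit.
Variables (R : realType) (up : R -> bool) (wall : set R) (u0 : bool -> R -> R).
Hypothesis unf : unfolding up wall u0.
Variable U : set_system nat.
Hypothesis UU : UltraFilter U.
Hypothesis U_oo : \oo `<=` U.

Definition mesh (i : nat) : R := i.+1%:R^-1.
Notation u i := (evol up u0 (mesh i)).

(** The number of steps of length 1/(i+1) that fit in the time t; it is 0 for
    negative t. *)
Definition steps (i : nat) (t : R) : nat := Num.truncn (t * i.+1%:R).

Lemma mesh_gt0 (i : nat) : 0 < mesh i.
Proof. by rewrite /mesh invr_gt0. Qed.

Lemma mesh_ge0 (i : nat) : 0 <= mesh i.
Proof. exact: ltW (mesh_gt0 i). Qed.

Lemma steps_itv i t : 0 <= t ->
  (steps i t)%:R * mesh i <= t < (steps i t)%:R * mesh i + mesh i.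
Proof.
move=> t0; have /truncn_itv : 0 <= t * i.+1%:R by rewrite mulr_ge0.
rewrite -/(steps i t) -(natr1 (steps i t)) => /andP[h1 h2].
rewrite /mesh; apply/andP; split; first by rewrite ler_pdivrMr ?ltr0n.
by rewrite -[X in _ < _ + X]mul1r -mulrDl ltr_pdivlMr ?ltr0n.
Qed.

Lemma steps_nat i k : steps i (k%:R * mesh i) = k.
Proof. by rewrite /steps /mesh mulfVK ?pnatr_eq0// natrK. Qed.

Lemma steps_le i s t : s <= t -> (steps i s <= steps i t)%N.
Proof. by move=> st; apply: le_truncn; rewrite ler_wpM2r. Qed.

Lemma steps_neg i t : t <= 0 -> steps i t = 0%N.
Proof.
move=> t0; apply/truncn0Pn; rewrite -ltNge (le_lt_trans _ ltr01)//.
by rewrite mulr_le0_ge0.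
Qed.

Lemma steps_dist i s t : 0 <= s -> 0 <= t ->
  `|(steps i s)%:R * mesh i - (steps i t)%:R * mesh i| <= `|s - t| + mesh i.
Proof.
move=> /(steps_itv i)/andP[h1 h2] /(steps_itv i)/andP[h3 h4].
move: (mesh i) h1 h2 h3 h4 => m h1 h2 h3 h4.
have := ler_norm (s - t); have := ler_norm (t - s); rewrite (distrC t).
by rewrite ler_norml => ? ?; apply/andP; split; lra.
Qed.

(** Joint equicontinuity in space and time, uniformly in the mesh: the
    modulus in x survives up to the earlier of the two times, and from there
    [evol_time] applies. *)
Lemma equicontinuity (M eta : R) : 0 < eta -> exists2 d, 0 < d &
  forall i b k j x y, `|x| + k%:R * mesh i <= M -> `|y| + j%:R * mesh i <= M ->
    `|x - y| <= d -> `|k%:R * mesh i - j%:R * mesh i| <= d ->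
    `|u i k b x - u i j b y| <= eta.
Proof.
move=> n0.
have [dt dt0 ht] := uniform_modulus UU U_oo (M + 1) (@unf_cont _ _ _ _ unf true) n0.
have [df df0 hf] := uniform_modulus UU U_oo (M + 1) (@unf_cont _ _ _ _ unf false) n0.
pose d := Num.min 1 (Num.min dt df).
have d0 : 0 < d by rewrite !lt_min dt0 df0 ltr01.
have [d1 d2 d3] : [/\ d <= 1, d <= dt & d <= df] by rewrite !ge_min !lexx !orbT.
have hd b x y : `|x| <= M + 1 -> `|y| <= M + 1 -> `|x - y| <= d -> `|u0 b x - u0 b y| <= eta.
  move=> hx hy xy; case: b.
    by apply: ht => //; exact: le_trans xy d2.
  by apply: hf => //; exact: le_trans xy d3.
exists (d / 2) => [|i b]; first by lra.
have main k j x y : `|y| + j%:R * mesh i <= M -> `|x - y| <= d / 2 ->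
    `|(j + k)%:R * mesh i - j%:R * mesh i| <= d / 2 ->
    `|u i (j + k)%N b x - u i j b y| <= eta.
  move=> hy xy; rewrite natrD mulrDl addrC addKr ger0_norm ?mulr_ge0 ?mesh_ge0// => kd.
  have := @evol_time _ _ _ _ unf (mesh i) (mesh_ge0 i) j k y d eta; apply; last by lra.
  move=> b' z zy; apply: (evol_modulus unf (mesh_ge0 i) hd (M := M + 1)) => //.
    by have := ler_normD (z - y) y; rewrite subrK; lra.
  by lra.
move=> k j x y hx hy xy kj.
have [jk|/ltnW kj'] := leqP j k.
  by have := @main (k - j)%N j x y; rewrite subnKC//; exact.
have := @main (j - k)%N k y x; rewrite subnKC// => h.
by rewrite distrC; apply: h => //; rewrite distrC.
Qed.

Lemma limit_exists : exists v : bool -> R * R -> R,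
  forall b x t, ulim U (fun i => u i (steps i t) b x) (v b (x, t)).
Proof.
suff h (q : bool * (R * R)) :
    exists l, ulim U (fun i => u i (steps i q.2.2) q.1 q.2.1) l.
  by have [f hf] := choice h; exists (fun b p => f (b, p)) => b x t; apply: (hf (b, (x, t))).
case: q => b [x t] /=.
have [Bt hBt] := local_bound UU U_oo (`|x| + `|t|) (@unf_cont _ _ _ _ unf true).
have [Bf hBf] := local_bound UU U_oo (`|x| + `|t|) (@unf_cont _ _ _ _ unf false).
apply: (@ulim_exists _ _ UU _ (Num.max Bt Bf)) => i.
apply: (@evol_bounded _ _ _ _ (mesh_ge0 i) _ (`|x| + `|t|)).
  by move=> b' y hy; rewrite le_max; case: b'; rewrite ?hBt ?hBf ?orbT.
rewrite lerD2l; have [t0|/ltW t0] := leP 0 t.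
  by have /andP[h _] := steps_itv i t0; rewrite ger0_norm.
by rewrite steps_neg// mul0r.
Qed.

Variable v : bool -> R * R -> R.
Hypothesis hv : forall b x t, ulim U (fun i => u i (steps i t) b x) (v b (x, t)).

Lemma limit_init b x : v b (x, 0) = u0 b x.
Proof.
apply/eqP; rewrite -subr_eq0 -normr_le0; apply: (ulim_dist UU (@hv b x 0) (ulim_cst UU (u0 b x))).
apply: filterS (filterT : U setT) => i _ /=.
by rewrite steps_neg// subrr normr0.
Qed.

(** Negative times carry the initial data; this makes the limit continuous
    on the whole plane and saves one-sided statements at t = 0. *)
Lemma limit_neg b x t : t <= 0 -> v b (x, t) = v b (x, 0).
Proof.
move=> t0.
apply/eqP; rewrite -subr_eq0 -normr_le0; apply: (ulim_dist UU (@hv b x t) (@hv b x 0)).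
apply: filterS (filterT : U setT) => i _ /=.
by rewrite !steps_neg// subrr normr0.
Qed.

Lemma limit_wall c t : wall c -> v true (c, t) = v false (c, t).
Proof.
move=> wc; apply/eqP; rewrite -subr_eq0 -normr_le0.
apply: (ulim_dist UU (@hv true c t) (@hv false c t)).
apply: filterS (filterT : U setT) => i _ /=.
by have := evol_reflect unf (mesh i) (steps i t) true c wc;
  rewrite (_ : 2 * c - c = c) => [->|]; [rewrite subrr normr0|lra].
Qed.

Lemma limit_order x t : up x -> v false (x, t) <= v true (x, t).
Proof.
move=> ux; rewrite -[leRHS]addr0; apply: (ulim_le UU (@hv false x t) (@hv true x t)).
apply: filterS (filterT : U setT) => i _ /=; rewrite addr0.
by have := evol_order unf (mesh i) (steps i t) x; rewrite ux.
Qed.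

Lemma equicontinuity_steps (M eta : R) : 0 < eta -> exists2 d, 0 < d &
  forall i b x y s t, mesh i <= d -> 0 <= s -> 0 <= t ->
    `|x| + s <= M -> `|y| + t <= M -> `|x - y| <= d -> `|s - t| <= d ->
    `|u i (steps i s) b x - u i (steps i t) b y| <= eta.
Proof.
move=> n0; have [d d0 h] := equicontinuity M n0.
exists (d / 2) => [|i b x y s t md s0 t0 hx hy xy st]; first by lra.
have /andP[s1 s2] := steps_itv i s0; have /andP[t1 t2] := steps_itv i t0.
have := steps_dist i s0 t0.
by move=> ?; apply: h; lra.
Qed.

Lemma limit_modulus (M eta : R) : 0 < eta -> exists2 d, 0 < d &
  forall b x y s t, 0 <= s -> 0 <= t ->
    `|x| + s <= M -> `|y| + t <= M -> `|x - y| <= d -> `|s - t| <= d ->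
    `|v b (x, s) - v b (y, t)| <= eta.
Proof.
move=> n0; have [d d0 h] := equicontinuity_steps M n0.
exists d => // b x y s t s0 t0 hx hy xy st.
apply: (ulim_dist UU (@hv b x s) (@hv b y t)).
by apply: filterS (ulim_mesh U_oo d0) => i /= hi; apply: h.
Qed.

Lemma limit_continuous b : continuous (v b).
Proof.
move=> [x t]; apply/cvgrPdist_le => eta n0 /=.
have [d d0 h] := limit_modulus (`|x| + Num.max t 0 + 2) n0.
have e0 : 0 < Num.min d 1 by rewrite lt_min d0 ltr01.
have vE y s : v b (y, s) = v b (y, Num.max s 0).
  by case: (leP s 0) => // s0; exact: limit_neg.
exists (ball x (Num.min d 1), ball t (Num.min d 1)).
  by split; exact: nbhsx_ballx.
move=> [y s] [] /=; rewrite /ball /= !lt_min => /andP[y1 y2] /andP[s1 s2].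
have ms : `|Num.max t 0 - Num.max s 0| <= `|t - s|.
  have t1 := ler_norm (t - s); have t2 := ler_norm (s - t); rewrite distrC in t2.
  by case: (leP t 0) => ?; case: (leP s 0) => ?; rewrite // ler_norml; apply/andP; split; lra.
have xy := ler_normD (y - x) x; rewrite subrK distrC in xy.
have ts := ler_norm (Num.max s 0 - Num.max t 0); rewrite distrC in ts.
rewrite (vE x) (vE y); apply: h; rewrite ?le_max ?lexx ?orbT//; lra.
Qed.

(** Otherwise there would be bad points for almost all i.  They have a
    limit along the ultrafilter, and equicontinuity of the schemes and of the
    limit contradicts convergence at that limit. *)
Lemma limit_uniform (M eta : R) : 0 < eta ->
  U [set i | forall b x t, `|x| <= M -> 0 <= t -> t <= M ->
    `|u i (steps i t) b x - v b (x, t)| <= eta].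
Proof.
move=> n0.
suff h b : U [set i | forall x t, `|x| <= M -> 0 <= t -> t <= M ->
    `|u i (steps i t) b x - v b (x, t)| <= eta].
  by apply: filterS (filterI (h true) (h false)) => i /= [h1 h2] [].
have [//|hU] := in_ultra_setVsetC [set i | forall x t, `|x| <= M -> 0 <= t -> t <= M ->
    `|u i (steps i t) b x - v b (x, t)| <= eta] UU.
exfalso.
have M0 : 0 <= M.
  have [i /= /existsNP[x /existsNP[t /not_implyP[h _]]]] := filter_ex hU.
  exact: le_trans h.
(* (0, 0) is a placeholder for the indices i without a bad point. *)
pose bad i (p : R * R) := eta < `|u i (steps i p.2) b p.1 - v b p|.
have hp (i : nat) : exists p : R * R, [/\ `|p.1| <= M, 0 <= p.2, p.2 <= M &
   ~ (forall x t, `|x| <= M -> 0 <= t -> t <= M ->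
    `|u i (steps i t) b x - v b (x, t)| <= eta) -> bad i p].
  case: (pselect (exists p : R * R, [/\ `|p.1| <= M, 0 <= p.2, p.2 <= M & bad i p])).
    by move=> [p [? ? ? ?]]; exists p; split.
  move=> h; exists (0, 0); split; rewrite //= ?normr0//; case=> x t hx t0 tM.
  by rewrite leNgt; apply/negP => hb; apply: h; exists (x, t).
have [p {}hp] := choice hp.
have [x hx] : exists x, ulim U (fun i => (p i).1) x.
  by apply: (@ulim_exists _ _ UU _ M) => i; case: (hp i).
have [t ht] : exists t, ulim U (fun i => (p i).2) t.
  by apply: (@ulim_exists _ _ UU _ M) => i; case: (hp i) => _ ? ? _; rewrite ger0_norm.
have t0 : 0 <= t.
  rewrite -[t]addr0; apply: (ulim_le UU (ulim_cst UU 0) ht).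
  by apply: filterS (filterT : U setT) => i _ /=; rewrite addr0; case: (hp i).
have n3 : 0 < eta / 4 by lra.
have [d d0 h] := equicontinuity_steps (`|x| + t + M + M) n3.
have [d' d'0 h'] := limit_modulus (`|x| + t + M + M) n3.
have [i /= [[[[[[hb h1] h2] h3] h4] h5] h6]] := filter_ex (filterI (filterI (filterI
  (filterI (filterI (filterI hU (hx _ d0)) (ht _ d0)) (hx _ d'0)) (ht _ d'0))
  (ulim_mesh U_oo d0)) (hv b x t n3)).
have [a1 a2 a3 /(_ hb)] := hp i; rewrite /bad.
case: (p i) h1 h2 h3 h4 a1 a2 a3 => y s /= h1 h2 h3 h4 a1 a2 a3.
have x0 := normr_ge0 x.
have k1 : `|u i (steps i s) b y - u i (steps i t) b x| <= eta / 4 by apply: h => //; lra.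
have k2 : `|v b (y, s) - v b (x, t)| <= eta / 4 by apply: h' => //; lra.
move: k1 k2 h6; rewrite !ler_norml ltNge => /andP[? ?] /andP[? ?] /andP[? ?] /negP; apply.
by rewrite ler_norml; apply/andP; split; lra.
Qed.

(** The weak inequality between v at a and w at b > a suffices: on the base
    the schemes satisfy it up to 2 * eta, and [evol_transport] keeps this
    error for all later times. *)
Lemma limit_transport (s x1 x2 x t : R) : 0 <= s -> s <= t ->
  x1 + (t - s) < x -> x < x2 - (t - s) ->
  (forall y : R, x1 < y -> y < x2 -> up y) ->
  (forall a b : R, x1 < a -> a < b -> b < x2 -> v false (b, s) <= v true (a, s)) ->
  v true (x, t) = v true (x - (t - s), s) /\
  v false (x, t) = v false (x + (t - s), s).
Proof.
move=> s0 st hx1 hx2 hup hle.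
pose rho := Num.min (x - (x1 + (t - s))) (x2 - (t - s) - x) / 2.
have [r0 r1 r2] : [/\ 0 < rho, x1 < x - (t - s) - rho & x + (t - s) + rho < x2].
  by rewrite /rho; case: (leP (x - (x1 + (t - s)))) => ?; split; lra.
pose r := (t - s) + rho; pose M := `|x| + r + t + 1.
have x0 := normr_ge0 x.
suff main (eta : R) : 0 < eta -> `|v true (x, t) - v true (x - (t - s), s)| <= 2 * eta + eta /\
    `|v false (x, t) - v false (x + (t - s), s)| <= 2 * eta + eta.
  split; apply/eqP; rewrite -subr_eq0 -normr_le0; apply/ler_addgt0Pr => eta n0.
    by have [] := main (eta / 5); lra.
  by have [] := main (eta / 5); lra.
move=> n0.
have [d d0 hd] := equicontinuity (M + M) n0.
pose good := [set i | (forall b (x t : R), `|x| <= M -> 0 <= t -> t <= M ->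
    `|u i (steps i t) b x - v b (x, t)| <= eta) /\ (mesh i <= d /\ mesh i <= rho)].
have hgood : U good.
  by apply: filterI (limit_uniform M n0) (filterI _ _); exact: ulim_mesh.
suff hg i : good i ->
    `|u i (steps i t) true x - u i (steps i s) true (x - (t - s))| <= 2 * eta + eta /\
    `|u i (steps i t) false x - u i (steps i s) false (x + (t - s))| <= 2 * eta + eta.
  split.
    apply: (ulim_dist UU (@hv true x t) (@hv true (x - (t - s)) s)).
    by apply: filterS hgood => i /hg[].
  apply: (ulim_dist UU (@hv false x t) (@hv false (x + (t - s)) s)).
  by apply: filterS hgood => i /hg[].
move=> [hu [hd1 hd2]].
have m0 := mesh_gt0 i.
have t0 : 0 <= t by lra.
have /andP[s1 s2] := steps_itv i s0; have /andP[t1 t2] := steps_itv i t0.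
have hst := steps_le i st.
have kE : ((steps i t - steps i s)%N)%:R * mesh i =
    (steps i t)%:R * mesh i - (steps i s)%:R * mesh i by rewrite natrB// mulrBl.
have win y : `|y - x| <= r -> x1 < y /\ y < x2.
  by rewrite ler_norml /r => /andP[? ?]; split; lra.
have winM y : `|y - x| <= r -> `|y| <= M.
  by move=> hy; have := ler_normD (y - x) x; rewrite subrK /M; lra.
have hth (a b : R) : a <= b -> `|a - x| <= r -> `|b - x| <= r ->
    u i (steps i s) false b <= u i (steps i s) true a + 2 * eta.
  rewrite le_eqVlt => /orP[/eqP <-|ab] ha hb.
    have [h1 h2] := win _ ha.
    have := evol_order unf (mesh i) (steps i s) a; rewrite (hup _ h1 h2) /=; lra.
  have [h1 _] := win _ ha; have [_ h2] := win _ hb.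
  have := hle _ _ h1 ab h2.
  have := hu true a s (winM _ ha) s0 ltac:(rewrite /M /r; lra).
  have := hu false b s (winM _ hb) s0 ltac:(rewrite /M /r; lra).
  by rewrite !ler_norml => /andP[? ?] /andP[? ?] ?; lra.
have hk : `|x - x| + ((steps i t - steps i s)%N)%:R * mesh i <= r.
  by rewrite subrr normr0 kE /r; lra.
have n2 : 0 <= 2 * eta by lra.
have := evol_transport (mesh_ge0 i) n2 (fun y hy => hup y (win y hy).1 (win y hy).2) hth hk.
rewrite subnKC// kE.
set k := _ - _ * mesh i => [[p1 p2 p3 p4]].
have inside y : `|y| <= r -> `|x + y| + (steps i s)%:R * mesh i <= M + M.
  move=> yr; have /winM hy : `|x + y - x| <= r by rewrite addrAC subrr add0r.
  by apply: lerD => //; apply: (le_trans s1); rewrite /M /r; lra.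
have k0 : 0 <= k by rewrite /k -kE mulr_ge0// ltW.
have kr : `|k| <= r by rewrite ger0_norm// /k -kE; move: hk; rewrite subrr normr0 add0r.
have tr : `|t - s| <= r by rewrite ger0_norm ?subr_ge0// lerDl ltW.
have kt : `|k - (t - s)| <= d.
  by apply: le_trans hd1; rewrite /k ler_norml; apply/andP; split; lra.
have q b y z : `|y| <= r -> `|z| <= r -> `|y - z| <= d ->
    `|u i (steps i s) b (x + y) - u i (steps i s) b (x + z)| <= eta.
  move=> yr zr yz; apply: hd; rewrite ?inside// ?subrr ?normr0 ?(ltW d0)//.
  by rewrite opprD addrACA subrr add0r.
split.
  apply: (sandwich_above p1 p2); apply: q; rewrite ?normrN//.
  by rewrite -opprD normrN.
exact: (sandwich_below p3 p4 (q _ _ _ kr tr kt)).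
Qed.

(** A gap at one point persists, by continuity, on a small space-time
    square; [limit_transport] is applied over a base slightly below the point. *)
Lemma limit_transport_at (x t rho : R) : 0 < t -> 0 < rho ->
  (forall y : R, `|y - x| < rho -> up y) -> v false (x, t) < v true (x, t) ->
  transport_at (v true) (v false) x t.
Proof.
move=> t0 rho0 hup gap.
pose eta := (v true (x, t) - v false (x, t)) / 2.
have n0 : 0 < eta by rewrite /eta; lra.
have [d d0 hd] := limit_modulus (`|x| + t + 2) n0.
pose r := Num.min (Num.min d rho) (Num.min t 1) / 2.
have [r0 [r1 r2] [r3 r4]] : [/\ 0 < r, r < d /\ r < rho & r < t /\ r < 1].
  have : 0 < Num.min (Num.min d rho) (Num.min t 1) by rewrite !lt_min d0 rho0 t0 ltr01.
  have : Num.min (Num.min d rho) (Num.min t 1) <= d by rewrite !ge_min lexx.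
  have : Num.min (Num.min d rho) (Num.min t 1) <= rho by rewrite !ge_min lexx orbT.
  have : Num.min (Num.min d rho) (Num.min t 1) <= t by rewrite !ge_min lexx !orbT.
  have : Num.min (Num.min d rho) (Num.min t 1) <= 1 by rewrite !ge_min lexx !orbT.
  by rewrite /r; split; lra.
(* The base is r / 3 below t, so that (x + d, t + d) and (x - d, t + d) lie in its triangle for |d| < r / 3. *)
pose s := t - r / 3.
have near b y : x - r < y -> y < x + r -> `|v b (y, s) - v b (x, t)| <= eta.
  move=> y1 y2.
  have hy : `|y - x| <= r by rewrite ler_norml; apply/andP; split; lra.
  have := ler_normD (y - x) x; rewrite subrK => ?.
  apply: hd; rewrite /s; try lra.
  by rewrite ler_norml; apply/andP; split; lra.
have T y t' : s <= t' -> x - r + (t' - s) < y -> y < x + r - (t' - s) ->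
  v true (y, t') = v true (y - (t' - s), s) /\
  v false (y, t') = v false (y + (t' - s), s).
  move=> st h1 h2; apply: limit_transport st h1 h2 _ _; first by rewrite /s; lra.
    by move=> z z1 z2; apply: hup; rewrite ltr_norml; apply/andP; split; lra.
  move=> a b h3 h4 h5.
  have := near true a h3 ltac:(lra); have := near false b ltac:(lra) h5.
  by rewrite !ler_norml /eta => /andP[? ?] /andP[? ?]; lra.
exists (r / 3) => [|e e1 e2]; first by lra.
have [||| -> _] := T (x + e) (t + e); rewrite /s; try lra.
have [||| _ ->] := T (x - e) (t + e); rewrite /s; try lra.
have [||| -> ->] := T x t; rewrite /s; try lra.
by split; congr (v _ (_, _)); lra.
Qed.

(** If the data are within eta of c1 and later of c2 throughout a window,
    the mass of v + w changes by about 2 * m * (c2 - c1), which [evol_mass]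
    bounds by the fluxes. *)
Lemma mass_defect k m N (e x w K eta c1 c2 : R) : 0 <= e -> m%:R * (2 * e) <= w ->
  (forall j, (j < N)%N -> `|flux up u0 e (k + 2 * j) x| <= K /\
     `|flux up u0 e (k + 2 * j) (x + m%:R * (2 * e))| <= K) ->
  (forall b y, x <= y -> y <= x + w -> `|evol up u0 e k b y - c1| <= eta) ->
  (forall b y, x <= y -> y <= x + w -> `|evol up u0 e (k + 2 * N) b y - c2| <= eta) ->
  m%:R * (2 * `|c2 - c1|) <= N%:R * (2 * K) + m%:R * (4 * eta).
Proof.
move=> e0 mw hK h1 h2.
have -> : 2 * `|c2 - c1| = `|2 * (c2 - c1)| by rewrite normrM (ger0_norm (ler0n _ 2)).
pose mass l j := evol up u0 e l true (x + j%:R * (2 * e)) +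
  evol up u0 e l false (x + j%:R * (2 * e)).
apply: (@sum_close _ (fun j => mass (k + 2 * N)%N j - mass k j) _ _ _ _ _ (evol_mass hK)) => j jm.
have j0 : 0 <= j%:R * (2 * e) by rewrite mulr_ge0 ?mulr_ge0.
have jw : j%:R * (2 * e) <= w.
  by apply: le_trans mw; rewrite ler_wpM2r ?mulr_ge0// ler_nat ltnW.
have y1 : x <= x + j%:R * (2 * e) by rewrite lerDl.
have y2 : x + j%:R * (2 * e) <= x + w by rewrite lerD2l.
move: (h1 true _ y1 y2) (h1 false _ y1 y2) (h2 true _ y1 y2) (h2 false _ y1 y2).
rewrite /mass; move: (evol _ _ _ _ _ _) (evol _ _ _ _ _ _) (evol _ _ _ _ _ _) (evol _ _ _ _ _ _).
clear=> a b c d; rewrite !ler_norml => /andP[? ?] /andP[? ?] /andP[? ?] /andP[? ?].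
by apply/andP; split; lra.
Qed.

(** The flux compares v with w at almost the same point, so that it tends to
    v - w, uniformly. *)
Lemma limit_flux (x1 x2 t1 t2 K : R) : 0 < K ->
  (forall y t, x1 <= y -> y <= x2 -> 0 <= t -> t1 <= t -> t <= t2 ->
     v true (y, t) = v false (y, t)) ->
  U [set i | forall j y, x1 <= y -> y <= x2 -> t1 <= j%:R * mesh i ->
     j%:R * mesh i <= t2 -> `|flux up u0 (mesh i) j y| <= K].
Proof.
move=> K0 heq; have K3 : 0 < K / 3 by lra.
pose M := `|x1| + `|x2| + `|t2| + 2.
have [d d0 hd] := equicontinuity M K3.
have g0 : 0 < Num.min d 1 by rewrite lt_min d0 ltr01.
apply: filterS (filterI (limit_uniform M K3) (ulim_mesh U_oo g0)).
move=> i [/= hu]; rewrite -/(mesh i) le_min => /andP[m1 m2] j y y1 y2 j1 j2.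
have m0 := mesh_ge0 i.
have je0 : 0 <= j%:R * mesh i by rewrite mulr_ge0.
have jt : j%:R * mesh i <= `|t2| by apply: le_trans j2 (ler_norm _).
have [x10 x20] := (normr_ge0 x1, normr_ge0 x2).
have yM : `|y| <= `|x1| + `|x2|.
  have := ler_norm x2; have := ler_norm (- x1).
  by rewrite normrN ler_norml; clear - y1 y2 x10 x20 => ? ?; apply/andP; split; lra.
have jS : j.+1%:R * mesh i = j%:R * mesh i + mesh i by rewrite -natr1 mulrDl mul1r.
have q1 : `|u i j.+1 true (y - mesh i) - u i j true y| <= K / 3.
  have := ler_normB y (mesh i); rewrite (ger0_norm m0) => yB.
  apply: hd; rewrite ?jS; try by rewrite /M; lra.
    by rewrite addrAC subrr add0r normrN ger0_norm.
  by rewrite addrC addKr ger0_norm.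
have q b : `|u i j b y - v b (y, j%:R * mesh i)| <= K / 3.
  have := hu b y (j%:R * mesh i); rewrite steps_nat; apply=> //; rewrite /M; lra.
have := q false; rewrite -(heq y (j%:R * mesh i))//; move: (q true) q1; rewrite /flux.
clear; rewrite !ler_norml => /andP[? ?] /andP[? ?] /andP[? ?].
by apply/andP; split; lra.
Qed.

(** Continuous convergence: the schemes at moving points near (x,s). *)
Lemma limit_locally (x s eta : R) : 0 <= s -> 0 < eta -> exists2 d, 0 < d &
  U [set i | forall b y j, `|y - x| <= d -> `|j%:R * mesh i - s| <= d ->
    `|u i j b y - v b (x, s)| <= eta].
Proof.
move=> s0 n0; have n2 : 0 < eta / 2 by lra.
pose M := `|x| + s + 2.
have [d d0 hd] := limit_modulus M n2.
exists (Num.min d 1); first by rewrite lt_min d0 ltr01.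
apply: filterS (limit_uniform M n2) => i /= hu b y j.
rewrite !le_min => /andP[y1 y2] /andP[j1 j2].
have je0 : 0 <= j%:R * mesh i by rewrite mulr_ge0 ?mesh_ge0.
have yM := ler_normD (y - x) x; rewrite subrK in yM.
have jM := ler_norm (j%:R * mesh i - s).
have x0 := normr_ge0 x.
have := hu b y (j%:R * mesh i); rewrite steps_nat.
have q : `|v b (y, j%:R * mesh i) - v b (x, s)| <= eta / 2.
  by apply: hd => //; rewrite /M; lra.
move=> /(_ ltac:(rewrite /M; lra) je0 ltac:(rewrite /M; lra)).
move: q; clear.
rewrite !ler_norml => /andP[? ?] /andP[? ?].
by apply/andP; split; lra.
Qed.

(** The window has width w, hence about w / (2 e) cells, and there are about
    (s2 - s1) / (2 e) double steps; choosing the flux bound K proportional to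
    eta * w / (s2 - s1 + 1) makes the total flux negligible. *)
Lemma limit_frozen (x s1 s2 r : R) : 0 <= s1 -> s1 <= s2 -> 0 < r ->
  (forall y t : R, x <= y -> y <= x + r -> 0 <= t -> s1 - r <= t -> t <= s2 ->
     v true (y, t) = v false (y, t)) ->
  v true (x, s1) = v true (x, s2).
Proof.
move=> s10 s12 r0 heq; have s20 := le_trans s10 s12.
set D := v true (x, s2) - v true (x, s1).
suff main (eta : R) : 0 < eta -> `|D| <= 4 * eta.
  apply/eqP; rewrite eq_sym -subr_eq0 -normr_le0; apply/ler_addgt0Pr => eta n0.
  by have := main (eta / 4); rewrite -/D; lra.
move=> n0.
have [d1 d10 hd1] := limit_locally x s10 n0.
have [d2 d20 hd2] := limit_locally x s20 n0.
pose w := Num.min (Num.min d1 d2) (Num.min r 1).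
have [w0 [w1 w2] [w3 w4]] : [/\ 0 < w, w <= d1 /\ w <= d2 & w <= r /\ w <= 1].
  by rewrite /w !lt_min !ge_min !lexx !orbT d10 d20 r0 ltr01.
have L0 : 0 < s2 - s1 + 1 by lra.
pose K := eta * w / (s2 - s1 + 1).
have K0 : 0 < K by rewrite divr_gt0// mulr_gt0.
have KE : K * (s2 - s1 + 1) = eta * w by rewrite /K divfK// gt_eqF.
have wq : 0 < w / 4 by lra.
have [i [[[/= hd1' hd2'] hf] /=]] := filter_ex (filterI (filterI (filterI hd1 hd2)
  (limit_flux K0 heq)) (ulim_mesh U_oo wq)).
have := mesh_gt0 i; rewrite -/(mesh i).
have := steps_itv i s10; have := steps_itv i s20; have := steps_le i s12.
move: hd1' hd2' hf; move: (mesh i) (steps i s1) (steps i s2) => e k1 k2.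
move=> hd1' hd2' hf k12 /andP[p3 p4] /andP[p1 p2] e0 ew.
have xr : x <= x + r by rewrite lerDl ltW.
have s1r : s1 - r <= s1 by rewrite gerBl ltW.
have e1 := heq x s1 (lexx x) xr s10 s1r s12.
have e2 := heq x s2 (lexx x) xr s20 (le_trans s1r s12) (lexx s2).
clear hd1 hd2 heq.
(* k1 + 2 * N is k2 or k2 - 1, according to parity. *)
pose N := ((k2 - k1) %/ 2)%N.
have N1 : (k1 + 2 * N <= k2)%N by rewrite -leq_subRL// mulnC leq_trunc_div.
have N2 : (k2 <= (k1 + 2 * N).+1)%N.
  rewrite -addnS -leq_subLR mulnC -ltnS -[X in (_ < X)%N]addn2.
  by rewrite -[X in (_ < _ + X)%N]mul1n -mulnDl addn1 ltn_ceil.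
have kE j : (k1 + 2 * j)%N%:R * e = k1%:R * e + j%:R * (2 * e).
  by rewrite natrD natrM mulrDl (mulrC 2) mulrA.
have N1' : (k1 + 2 * N)%N%:R * e <= k2%:R * e by rewrite ler_wpM2r ?ler_nat// ltW.
have N2' : k2%:R * e <= (k1 + 2 * N)%N%:R * e + e.
  by rewrite -[X in _ + X]mul1r -mulrDl natr1 ler_wpM2r ?ler_nat// ltW.
have ee0 : 0 < 2 * e by rewrite mulr_gt0.
pose m := Num.truncn (w / (2 * e)).
have me1 : m%:R * (2 * e) <= w.
  by rewrite -ler_pdivlMr// truncn_le divr_ge0// ltW.
have me2 : w < m%:R * (2 * e) + 2 * e.
  by rewrite -[X in _ + X]mul1r -mulrDl natr1 -ltr_pdivrMr// truncnS_gt.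
have m0 : 0 <= m%:R * (2 * e) by rewrite mulr_ge0// ltW.
have nearx y : x <= y -> y <= x + w -> `|y - x| <= w.
  by move=> y1 y2; rewrite ger0_norm ?subr_ge0// lerBlDl.
have t1 : `|k1%:R * e - s1| <= w.
  rewrite distrC ger0_norm ?subr_ge0// lerBlDl (le_trans (ltW p2))// lerD2l.
  by rewrite (le_trans ew)// ler_pdivrMr// ler_peMr ?ler1n// ltW.
have t2 : `|(k1 + 2 * N)%N%:R * e - s2| <= w.
  by rewrite ler_norml; apply/andP; split; lra.
have near1 b y : x <= y -> y <= x + w -> `|evol up u0 e k1 b y - v true (x, s1)| <= eta.
  move=> y1 y2; rewrite (_ : v true (x, s1) = v b (x, s1)); last by case: (b).
  by apply: hd1'; [apply: le_trans (nearx _ y1 y2) w1|apply: le_trans t1 w1].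
have near2 b y : x <= y -> y <= x + w ->
    `|evol up u0 e (k1 + 2 * N) b y - v true (x, s2)| <= eta.
  move=> y1 y2; rewrite (_ : v true (x, s2) = v b (x, s2)); last by case: (b).
  by apply: hd2'; [apply: le_trans (nearx _ y1 y2) w2|apply: le_trans t2 w2].
have fl j : (j < N)%N -> `|flux up u0 e (k1 + 2 * j) x| <= K /\
     `|flux up u0 e (k1 + 2 * j) (x + m%:R * (2 * e))| <= K.
  move=> jN.
  have j1 : s1 - r <= (k1 + 2 * j)%N%:R * e.
    have j0 : 0 <= j%:R * (2 * e) by rewrite mulr_ge0// ltW.
    by rewrite kE; lra.
  have j2 : (k1 + 2 * j)%N%:R * e <= s2.
    apply: le_trans p3; apply: le_trans N1'.
    apply: ler_wpM2r; first exact: ltW.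
    by rewrite ler_nat leq_add2l leq_mul2l ltnW ?orbT.
  by split; apply: hf; rewrite ?lerDl ?lerD2l ?(le_trans me1 w3) ?(ltW r0).
have := mass_defect (ltW e0) me1 fl near1 near2; rewrite -/D.
have : N%:R * (2 * e) <= s2 - s1 + 1 by have := kE N; lra.
have : w <= 4 * (m%:R * e) by lra.
have : 0 < m%:R * e by lra.
move: (m%:R) (N%:R) (`|D|) (s2 - s1 + 1) L0 KE K0 n0 e0 w0; clear.
move=> m N D L L0 KE K0 n0 e0 w0 me0 wm NL H.
have h1 : m * (2 * D) * e <= (N * (2 * K) + m * (4 * eta)) * e by rewrite ler_wpM2r// ltW.
have h2 : N * (2 * e) * K <= L * K by rewrite ler_wpM2r// ltW.
have h3 : eta * w <= eta * (4 * (m * e)) by rewrite ler_wpM2l// ltW.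
by rewrite -(ler_pM2l me0); lra.
Qed.

Variable I : set R.
Hypothesis I_up : forall x y, I x -> I y -> x < y -> up x.

(** The functions v' and w' are constant along the characteristics down to
    the base.  The characteristics from (a,s) to the right and from (b,s) to the
    left meet at an interior point, where w' < v'; this orders the data on the
    base as [limit_transport] requires. *)
Lemma limit_thawing : thawing_condition I (v true) (v false).
Proof.
move=> s x1 x2 s0 x12 hI v' w' cv cw gap [/(_ gap) tr _] init [x t] /interior_triangle [st h1 h2].
have start a : x1 < a -> a < x2 -> triangle s x1 x2 (a, s).
  by move=> ? ?; split => /=; rewrite ?subrr; lra.
have right a r : x1 < a -> a + 2 * r < x2 -> 0 < r -> v' (a + r, s + r) = v' (a, s).
  move=> a1 a2 r0; have := @characteristic R _ v' a s 1 r cv; rewrite mul1r; apply => //.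
    by apply: start; lra.
  move=> z z0 zr; have hz : interior (triangle s x1 x2) (a + z, s + z).
    by apply/interior_triangle; split; lra.
  split; first by rewrite mul1r; exact: interior_subset hz.
  have [e e0 he] := tr _ _ hz; exists e => // d d1 d2.
  by rewrite !mul1r !addrA; case: (he d d1 d2).
have left b r : x1 < b - 2 * r -> b < x2 -> 0 < r -> w' (b - r, s + r) = w' (b, s).
  move=> b1 b2 r0; have := @characteristic R _ w' b s (-1) r cw; rewrite mulN1r; apply => //.
    by apply: start; lra.
  move=> z z0 zr; have hz : interior (triangle s x1 x2) (b - z, s + z).
    by apply/interior_triangle; split; lra.
  split; first by rewrite mulN1r; exact: interior_subset hz.
  have [e e0 he] := tr _ _ hz; exists e => // d d1 d2.
  by rewrite !mulN1r opprD !addrA; case: (he d d1 d2).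
have up12 y : x1 < y -> y < x2 -> up y.
  move=> y1 y2; apply: (@I_up y ((y + x2) / 2)); last by lra.
    by apply: hI => /=; rewrite in_itv /=; apply/andP.
  by apply: hI => /=; rewrite in_itv /=; apply/andP; split; lra.
have ordered a b : x1 < a -> a < b -> b < x2 -> v false (b, s) <= v true (a, s).
  move=> a1 ab b2; pose r := (b - a) / 2.
  have hp : interior (triangle s x1 x2) (a + r, s + r).
    by apply/interior_triangle; rewrite /r; split; lra.
  have := gap _ hp; rewrite right//; [|by rewrite /r; lra|by rewrite /r; lra].
  have -> : a + r = b - r by rewrite /r; lra.
  rewrite left//; [|by rewrite /r; lra|by rewrite /r; lra].
  have [-> _] := init a a1 ltac:(lra); have [_ ->] := init b ltac:(lra) b2.
  exact: ltW.
have [-> ->] := limit_transport s0 (ltW st) h1 h2 up12 ordered.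
have := @right (x - (t - s)) (t - s); have := @left (x + (t - s)) (t - s).
rewrite addrK subrK (_ : s + (t - s) = t); last by lra.
move=> -> ; [move=> -> | | | ]; try lra.
have [-> _] := init (x - (t - s)) ltac:(lra) ltac:(lra).
by have [_ ->] := init (x + (t - s)) ltac:(lra) ltac:(lra).
Qed.

Lemma limit_transport_with_freezing D : open D -> D `<=` I `*` [set t : R | 0 < t] ->
  transport_with_freezing (v true) (v false) D.
Proof.
move=> oD DI.
have box x t : D (x, t) -> exists2 r, 0 < r &
    forall y s, `|y - x| < r -> `|s - t| < r -> D (y, s).
  by move=> Dxt; have /nbhs_box := open_nbhs_nbhs (conj oD Dxt).
split=> hD x t Dxt; have [/= Ix t0] := DI _ Dxt; have [r r0 hr] := box x t Dxt.
  apply: (limit_transport_at t0 r0) => [y yx|]; last exact: hD.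
  have tt : `|t - t| < r by rewrite subrr normr0.
  have [/= Iy _] := DI _ (hr _ _ yx tt).
  move: yx; rewrite ltr_norml => /andP[y1 y2].
  have yx' : `|(y + (x + r)) / 2 - x| < r by rewrite ltr_norml; apply/andP; split; lra.
  have [/= Iy' _] := DI _ (hr _ _ yx' tt).
  by apply: (I_up Iy Iy'); lra.
have fr s1 s2 : 0 <= s1 -> s1 <= s2 -> t - r / 2 < s1 -> s2 < t + r / 2 ->
    v true (x, s1) = v true (x, s2).
  move=> s10 s12 s1t s2t.
  have r2 : 0 < r / 2 by lra.
  apply: (limit_frozen s10 s12 r2) => y s y1 y2 ss0 h1 h2.
  by apply: hD; apply: hr; rewrite ltr_norml; apply/andP; split; lra.
exists (Num.min (r / 2) t) => [|d]; first by rewrite lt_min t0 andbT; lra.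
rewrite lt_min => d1 /andP[d2 d3].
have [d4 d5] : - (r / 2) < d /\ - t < d.
  by move: d1; case: (leP (r / 2) t) => ? ?; split; lra.
have vE : v true (x, t + d) = v true (x, t).
  have [d0|d0] := leP 0 d; first by apply/esym/fr; lra.
  by apply: fr; lra.
split=> //; rewrite -(hD _ Dxt) -vE; apply/esym/hD; apply: hr.
  by rewrite subrr normr0.
by rewrite (addrC t) addrK ltr_norml; apply/andP; split; lra.
Qed.

End Limit.

Lemma unfolded_solution (R : realType) (up : R -> bool) (wall : set R)
    (u0 : bool -> R -> R) (I : set R) : unfolding up wall u0 ->
  (forall x y, I x -> I y -> x < y -> up x) -> (forall x, I x -> up x \/ wall x) ->
  exists v w : R * R -> R,
    [/\ continuous v, continuous w,
        forall x, v (x, 0) = u0 true x /\ w (x, 0) = u0 false x,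
        forall c t, wall c -> v (c, t) = w (c, t) &
        [/\ forall x t, I x -> w (x, t) <= v (x, t),
            thawing_condition I v w &
            forall D, open D -> D `<=` I `*` [set t : R | 0 < t] ->
              transport_with_freezing v w D]].
Proof.
move=> unf I_up I_wall.
have [U [UU U_oo]] := @ultraFilterLemma nat \oo _.
have [v hv] := limit_exists unf UU U_oo.
exists (v true), (v false).
have vwall c t : wall c -> v true (c, t) = v false (c, t).
  by move=> wc; apply: (limit_wall unf UU hv).
split=> //.
- exact (@limit_continuous _ _ _ _ unf _ UU U_oo _ hv true).
- exact (@limit_continuous _ _ _ _ unf _ UU U_oo _ hv false).
- by move=> x; rewrite !(limit_init UU hv).
split.
- move=> x t /I_wall[ux|wx]; last by rewrite vwall.
  exact: (limit_order unf UU hv).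
- exact (limit_thawing unf UU U_oo hv I_up).
- exact (limit_transport_with_freezing unf UU U_oo hv I_up).
Qed.

(** * Unfolding the segment *)

Section Unfold.
Variables (R : realType) (a1 a2 : R).
Hypothesis a12 : a1 < a2.
Let L := a2 - a1.
Let L0 : 0 < L. Proof. by rewrite subr_gt0. Qed.

(** The unfolded line has period 2 * (a2 - a1); [sheet] numbers the periods,
    [phase] is the position inside one of them. *)
Definition sheet (x : R) : int := Num.floor ((x - a1) / (2 * (a2 - a1))).
Definition phase (x : R) : R := x - a1 - (sheet x)%:~R * (2 * (a2 - a1)).
Definition upper (x : R) : bool := phase x < a2 - a1.
Definition folding (x : R) : R := a1 + Num.min (phase x) (2 * (a2 - a1) - phase x).
Definition mirrors : set R := [set c | exists m : int, c = a1 + m%:~R * (a2 - a1)].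

Lemma phase_itv x : 0 <= phase x < 2 * L.
Proof.
rewrite /phase -/L; have /andP[h1 h2] := floor_itv ((x - a1) / (2 * L)).
have P0 : 0 < 2 * L by have := L0; lra.
move: h1 h2; rewrite -/L ler_pdivlMr// ltr_pdivrMr// intrD1.
by rewrite /sheet -/L => ? ?; apply/andP; split; lra.
Qed.

Lemma sheet_unique x (k : int) : 0 <= x - a1 - k%:~R * (2 * L) < 2 * L -> sheet x = k.
Proof.
have P0 : 0 < 2 * L by have := L0; lra.
move=> /andP[h1 h2]; apply: floor_def; rewrite -/L ler_pdivlMr// ltr_pdivrMr//.
by rewrite intrD1; apply/andP; split; lra.
Qed.

Lemma phase_unique x (k : int) (p : R) : 0 <= p < 2 * L ->
  x = a1 + k%:~R * (2 * L) + p -> phase x = p.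
Proof.
move=> hp xE; have pE : x - a1 - k%:~R * (2 * L) = p by lra.
by rewrite /phase (@sheet_unique x k) ?pE.
Qed.

Lemma phaseE x : x = a1 + (sheet x)%:~R * (2 * L) + phase x.
Proof. by rewrite /phase -/L; lra. Qed.

Lemma phase_mirror x : phase x = 0 \/ phase x = L -> mirrors x.
Proof.
have := phaseE x; move=> xE [p0|pL].
  by exists (2 * sheet x); rewrite -/L intrM; lra.
by exists (2 * sheet x + 1); rewrite -/L intrD intrM; lra.
Qed.

Lemma phase_reflect c x : mirrors c ->
  (phase x = 0 /\ phase (2 * c - x) = 0) \/
  (0 < phase x /\ phase (2 * c - x) = 2 * L - phase x).
Proof.
move=> [m ->]; have /andP[p0 p1] := phase_itv x; have xE := phaseE x.
move: p0; rewrite le_eqVlt => /orP[/eqP p0|p0].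
  left; split=> //; apply: (@phase_unique _ (m - sheet x)).
    by have := L0; rewrite lexx /=; lra.
  by rewrite intrB -/L; lra.
right; split=> //; apply: (@phase_unique _ (m - sheet x - 1)).
  by apply/andP; split; lra.
by rewrite !intrB -/L; lra.
Qed.

Lemma folding_reflect c x : mirrors c -> folding (2 * c - x) = folding x.
Proof.
move=> /(phase_reflect x); rewrite /folding -/L => -[[-> ->]//|[_ ->]].
by rewrite subKr minC.
Qed.

Lemma upper_reflect c x : mirrors c -> mirrors x \/ upper (2 * c - x) = ~~ upper x.
Proof.
move=> /(phase_reflect x)[[p0 _]|[_ pE]]; first by left; apply: phase_mirror; left.
have [pL|pL] := eqVneq (phase x) L; first by left; apply: phase_mirror; right.
right; rewrite /upper pE -/L -leNgt.
by apply/idP/idP => h; [lra|move: pL h; rewrite le_eqVlt eq_sym => /negPf -> /= ?; lra].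
Qed.

Lemma folding_mirror c : mirrors c -> folding c = a1 \/ folding c = a2.
Proof.
move=> mc; have := phase_reflect c mc; rewrite (_ : 2 * c - c = c); last by lra.
rewrite /folding -/L => -[[-> _]|[_ pE]].
  by left; rewrite min_l ?addr0// subr0; have := L0; lra.
by right; rewrite (_ : phase c = L); [rewrite min_l; rewrite /L; lra|lra].
Qed.

Lemma mirror_between x y : upper x != upper y -> x <= y ->
  exists2 c, mirrors c & x <= c <= y.
Proof.
move=> + xy; have /andP[p0 p1] := phase_itv x; have /andP[q0 q1] := phase_itv y.
have xE := phaseE x; have yE := phaseE y.
have same c : c <= y -> a1 + (sheet y)%:~R * (2 * L) <= c -> c < x ->
    phase x = x - a1 - (sheet y)%:~R * (2 * L).
  by move=> ? ? ?; apply: (@phase_unique _ (sheet y)); [apply/andP; split|]; lra.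
rewrite /upper -/L; case: (ltP (phase y) L) => hy; case: (ltP (phase x) L) => hx // _.
  exists (a1 + (sheet y)%:~R * (2 * L)); first by exists (2 * sheet y); rewrite intrM -/L; lra.
  have c1 : a1 + (sheet y)%:~R * (2 * L) <= y by lra.
  by rewrite c1 andbT leNgt; apply/negP => c2; have := same _ c1 (lexx _) c2; lra.
exists (a1 + (sheet y)%:~R * (2 * L) + L).
  by exists (2 * sheet y + 1); rewrite intrD intrM -/L; lra.
have c1 : a1 + (sheet y)%:~R * (2 * L) + L <= y by lra.
rewrite c1 andbT leNgt; apply/negP => c2.
by have := same _ c1 _ c2; have := L0; lra.
Qed.

Lemma folding_itv x : a1 <= folding x <= a2.
Proof.
have /andP[p0 p1] := phase_itv x; have LE : L = a2 - a1 by []; rewrite /folding -/L.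
by case: (leP (phase x) (2 * L - phase x)) => ?; apply/andP; split; lra.
Qed.

(** Together with [folding_attained]: the distance of the folded point to a1
    is the distance of x to the lattice of the images of a1.  This makes
    [folding_lipschitz] immediate. *)
Lemma folding_le x (m : int) : folding x - a1 <= `|x - a1 - m%:~R * (2 * L)|.
Proof.
have /andP[p0 p1] := phase_itv x; have xE := phaseE x.
rewrite /folding -/L addrAC subrr add0r ge_min.
have [h|h] := leP m (sheet x).
  have : 0 <= ((sheet x - m)%:~R : R) * (2 * L) by rewrite mulr_ge0 ?ler0z ?subr_ge0//; have := L0; lra.
  have := ler_norm (x - a1 - m%:~R * (2 * L)).
  by rewrite intrB => ? ?; apply/orP; left; lra.
have : 0 <= ((m - sheet x - 1)%:~R : R) * (2 * L).
  by rewrite mulr_ge0 ?ler0z ?subr_ge0 ?lez1D// -?ltzD1 ?subr_gt0//; have := L0; lra.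
have := ler_norm (- (x - a1 - m%:~R * (2 * L))); rewrite normrN.
by rewrite !intrB => ? ?; apply/orP; right; lra.
Qed.

Lemma folding_attained x : exists m : int, `|x - a1 - m%:~R * (2 * L)| = folding x - a1.
Proof.
have /andP[p0 p1] := phase_itv x; have xE := phaseE x.
rewrite /folding -/L addrAC subrr add0r.
case: (leP (phase x) (2 * L - phase x)) => ?.
  by exists (sheet x); rewrite ger0_norm; lra.
by exists (sheet x + 1); rewrite intrD ler0_norm; lra.
Qed.

Lemma folding_lipschitz x y : `|folding x - folding y| <= `|x - y|.
Proof.
have main z t : folding z - folding t <= `|z - t|.
  have [m hm] := folding_attained t; have := folding_le z m.
  have := ler_normD (z - t) (t - a1 - m%:~R * (2 * L)).
  by rewrite addrA subrKA hm; lra.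
by rewrite ler_norml; have := main x y; have := main y x; rewrite (distrC y x); lra.
Qed.

Lemma phase_segment x : a1 <= x -> x <= a2 -> phase x = x - a1.
Proof.
move=> x1 x2; apply: (@phase_unique _ 0); last by lra.
by have := L0; rewrite /L => ?; apply/andP; split; lra.
Qed.

Lemma folding_segment x : a1 <= x -> x <= a2 -> folding x = x.
Proof. by move=> x1 x2; rewrite /folding phase_segment// min_l; lra. Qed.

Variables v0 w0 : R -> R.
Hypothesis cv : {within `[a1, a2], continuous v0}.
Hypothesis cw : {within `[a1, a2], continuous w0}.
Hypothesis vw : forall x, a1 <= x <= a2 -> w0 x <= v0 x.
Hypothesis end1 : v0 a1 = w0 a1.
Hypothesis end2 : v0 a2 = w0 a2.

Definition unfold (b : bool) (x : R) : R :=
  if b == upper x then v0 (folding x) else w0 (folding x).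

Lemma unfold_mirror c : mirrors c -> v0 (folding c) = w0 (folding c).
Proof. by move=> /folding_mirror[] ->. Qed.

(** Two points on different sheets are compared through a mirror c
    between them, where the two branches agree. *)
Lemma unfold_continuous b : continuous (unfold b).
Proof.
move=> x; apply/cvgrPdist_le => eta n0; have n3 : 0 < eta / 3 by lra.
have Ix : `[a1, a2]%classic (folding x) by rewrite /= in_itv /= folding_itv.
have local (f : R -> R) : {within `[a1, a2], continuous f} -> exists2 d, 0 < d &
    forall y, `|x - y| < d -> `|f (folding x) - f (folding y)| <= eta / 3.
  move=> /subspace_continuousP /(_ _ Ix) /cvgrPdist_le/(_ _ n3).
  rewrite /prop_near1 /within /= => /nbhs_ballP[d /= d0 hd]; exists d => // y xy.
  apply: hd; last by rewrite in_itv /= folding_itv.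
  exact: le_lt_trans (folding_lipschitz _ _) xy.
have [dv dv0 hv] := local v0 cv; have [dw dw0 hw] := local w0 cw.
apply/nbhs_ballP; exists (Num.min dv dw) => /=; first by rewrite lt_min dv0.
move=> y; rewrite /ball /= lt_min => /andP[yv yw].
rewrite /unfold.
have [->|ne] := eqVneq (upper y) (upper x).
  by have := hv _ yv; have := hw _ yw; case: eqP => _; lra.
have [c mc cE] : exists2 c, mirrors c & `|x - c| <= `|x - y|.
  have [xy|yx] := leP x y.
    have [c mc /andP[c1 c2]] := mirror_between (negbT (introF eqP (fun h => elimN eqP ne (esym h)))) xy.
    by exists c => //; rewrite !ler0_norm; lra.
  have [c mc /andP[c1 c2]] := mirror_between ne (ltW yx).
  by exists c => //; rewrite !ger0_norm; lra.
have hvc := hv c (le_lt_trans cE yv); have hwc := hw c (le_lt_trans cE yw).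
rewrite (unfold_mirror mc) in hvc.
have n1 : eta / 3 <= eta by lra.
case: eqP => _; case: eqP => _.
- exact: le_trans (hv _ yv) n1.
- exact: dist_chain hvc hwc (hw _ yw).
- exact: dist_chain hwc hvc (hv _ yv).
- exact: le_trans (hw _ yw) n1.
Qed.

Lemma segment_unfolding : unfolding upper mirrors unfold.
Proof.
split.
- exact: mirror_between.
- by move=> c x; exact: upper_reflect.
- move=> c b x mc; rewrite /unfold folding_reflect//.
  have [mx|->] := upper_reflect x mc; first by rewrite unfold_mirror// !if_same.
  by case: b; case: (upper x).
- move=> x; rewrite /unfold eqxx (_ : (~~ upper x == upper x) = false); last by case: (upper x).
  exact/vw/folding_itv.
- exact: unfold_continuous.
Qed.

Lemma segment_upper x y : `[a1, a2]%classic x -> `[a1, a2]%classic y -> x < y -> upper x.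
Proof.
rewrite /= !in_itv /= => /andP[x1 x2] /andP[y1 y2] xy.
by rewrite /upper phase_segment//; lra.
Qed.

Lemma segment_mirror x : `[a1, a2]%classic x -> upper x \/ mirrors x.
Proof.
rewrite /= in_itv /= => /andP[x1 x2].
rewrite /upper phase_segment//; move: x2; rewrite le_eqVlt => /orP[/eqP ->|x2].
  by right; exists 1; lra.
by left; lra.
Qed.

Lemma unfold_segment x : `[a1, a2]%classic x -> unfold true x = v0 x /\ unfold false x = w0 x.
Proof.
move=> Ix; have /andP[x1 x2] : a1 <= x <= a2 by move: Ix; rewrite /= in_itv.
rewrite /unfold; have [ux|mx] := segment_mirror Ix; first by rewrite ux folding_segment.
by have := unfold_mirror mx; rewrite folding_segment// => ->; rewrite !if_same.
Qed.
End Unfold.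

Lemma line_unfolding (R : realType) (v0 w0 : R -> R) :
  continuous v0 -> continuous w0 -> (forall x, w0 x <= v0 x) ->
  unfolding (fun=> true) set0 (fun b : bool => if b then v0 else w0).
Proof. by move=> cv cw vw; split=> // -[]. Qed.

Theorem theorem2p3 (R : realType) (I : set R) (v0 w0 : R -> R)
    (hI : line_or_segment I)
    (hv0 : {within I, continuous v0})
    (hw0 : {within I, continuous w0})
    (hvw0 : forall x : R, I x -> w0 x <= v0 x)
    (hbd0 : agree_at_endpoints I v0 w0) :
  exists v w : R * R -> R,
    {within I `*` [set t : R | 0 <= t], continuous v} /\
    {within I `*` [set t : R | 0 <= t], continuous w} /\
    (forall x : R, I x -> v (x, 0) = v0 x /\ w (x, 0) = w0 x) /\
    (forall x t : R, I x -> 0 <= t -> w (x, t) <= v (x, t)) /\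
    (forall t : R, 0 <= t ->
       agree_at_endpoints I (fun x => v (x, t)) (fun x => w (x, t))) /\
    thawing_condition I v w /\
    (forall D : set (R * R), open D -> D `<=` I `*` [set t : R | 0 < t] ->
       (forall p, D p -> w p < v p) \/ (forall p, D p -> v p = w p) ->
       transport_with_freezing v w D).
Proof.
suff [up [wall [u0 [unf I_up I_wall u0E ends]]]] : exists (up : R -> bool) (wall : set R)
    (u0 : bool -> R -> R), [/\ unfolding up wall u0,
      forall x y, I x -> I y -> x < y -> up x, forall x, I x -> up x \/ wall x,
      forall x, I x -> u0 true x = v0 x /\ u0 false x = w0 x &
      forall b1 b2, b1 < b2 -> I = `[b1, b2]%classic -> wall b1 /\ wall b2].
  have [v [w [cv cw init vw [le thaw trans]]]] := unfolded_solution unf I_up I_wall.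
  exists v, w; split; first exact: continuous_subspaceT.
  split; first exact: continuous_subspaceT.
  split; first by move=> x Ix; have [-> ->] := init x; exact: u0E.
  split; first by move=> x t Ix _; exact: le.
  split.
    move=> t _ b1 b2 b12 IE; have [wb1 wb2] := ends _ _ b12 IE.
    by rewrite !vw.
  by split=> // D oD DI _; exact: trans.
case: hI => [IT|[a1 [a2 [a12 IE]]]].
  exists (fun=> true), set0, (fun b : bool => if b then v0 else w0); split => //.
  - apply: line_unfolding; first by apply/continuous_subspace_setT; rewrite -IT.
      by apply/continuous_subspace_setT; rewrite -IT.
    by move=> x; apply: hvw0; rewrite IT.
  - by move=> x _; left.
  - move=> b1 b2 b12; rewrite IT => E; exfalso.
    have : [set: R] (b2 + 1) by [].
    by rewrite E /= in_itv /= => /andP[_]; rewrite gerDl ler10.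
have [e1 e2] := hbd0 _ _ a12 IE; subst I.
exists (upper a1 a2), (mirrors a1 a2), (unfold a1 a2 v0 w0); split.
- by apply: segment_unfolding => // x ?; apply: hvw0; rewrite /= in_itv.
- by move=> x y; exact: segment_upper.
- by move=> x; exact: segment_mirror.
- by move=> x; exact: unfold_segment.
move=> b1 b2 b12 E.
have memE x : (a1 <= x <= a2) = (b1 <= x <= b2).
  apply/idP/idP => h.
    have : `[a1, a2]%classic x by rewrite /= in_itv.
    by rewrite E /= in_itv.
  have : `[b1, b2]%classic x by rewrite /= in_itv.
  by rewrite -E /= in_itv.
have := memE a1; have := memE a2; have := memE b1; have := memE b2.
rewrite !lexx (ltW a12) (ltW b12) /=.
move=> /andP[_ h1] /andP[h2 _] /esym/andP[_ h3] /esym/andP[h4 _].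
have -> : b1 = a1 by apply/eqP; rewrite eq_le h4.
have -> : b2 = a2 by apply/eqP; rewrite eq_le h1.
by split; [exists 0; rewrite mul0r addr0|exists 1; rewrite mul1r subrKC].
Qed.
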